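(* Let $H$, $h$, $g$ be as in the context and suppose that (h-regularity), (g-structure), (g-compactness), (H-growth), (H-smoothness), (monotonicity) and (degenerate structure with lower semicontinuity), all formulated in the context, hold. Let $(m^\epsilon,u^\epsilon)\in D(A^\epsilon)$ be solutions of the regularized system (given in the context). Let $(m,u)\in L^1(\mathbb{T}^d)\times W^{1,\gamma}(\mathbb{T}^d)$, with $m\ge0$ and $\int_{\mathbb{T}^d}m\,dx=1$, be a weak solution of the mean-field game system (given in the context) obtained as a weak sublimit of $(m^\epsilon,u^\epsilon)_\epsilon$ in $L^1(\mathbb{T}^d)\times W^{1,\gamma}(\mathbb{T}^d)$ as $\epsilon\to(0,0)$, i.e. as the weak limit along some sequence of parameters $\epsilon$ tending to $(0,0)$. Then $(m,u)$ is a subsolution in the sense of distributions of the Hamilton–Jacobi equation: for all $\varphi\in C^\infty(\mathbb{T}^d)$ with $\varphi\ge0$, $$\int_{\mathbb{T}^d}\Big[\varphi(x)\big(u+H_0(x,Du,m,h(m))\big)-\big(\varphi(x)a_{ij}(x)\big)_{x_ix_j}u\Big]dx\le0.$$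
   Context: Setting. $\mathbb{T}^d=\mathbb{R}^d/\mathbb{Z}^d$, $d\ge1$; $\mathbb{E}$ is a fixed set, either $(0,\infty)$ or $[0,\infty)$. $\mathcal{M}_{ac}(\mathbb{T}^d)$ is the space of positive measures on $\mathbb{T}^d$ absolutely continuous with respect to Lebesgue measure; such a measure is identified with its density $m\in L^1(\mathbb{T}^d)$, $m\ge0$ a.e. Given are $H:\mathbb{T}^d\times\mathbb{R}^d\times\mathbb{R}^{d\times d}\times\mathbb{E}\times\mathbb{R}\to\mathbb{R}$, $(x,p,M,m,\theta)\mapsto H(x,p,M,m,\theta)$, a (possibly nonlinear) operator $h:\mathcal{M}_{ac}(\mathbb{T}^d)\to C(\mathbb{T}^d)$ ($h(m)$ is its value at the measure with density $m$), and a continuous function $g:\mathbb{T}^d\times\mathbb{E}\times\mathbb{R}\to\mathbb{R}$. $H(x,Du,D^2u,m,h(m))$ denotes $x\mapsto H(x,Du(x),D^2u(x),m(x),h(m)(x))$, and similarly for derivatives of $H$, for $H_0$ and for $g,g_1,g_2$. Repeated indices $i,j\in\{1,\dots,d\}$ are summed; $M_1:M_2=\operatorname{tr}(M_1M_2)$ for symmetric matrices. Conditions over $m\in\mathcal{M}_{ac}(\mathbb{T}^d)$ involving $g$ or $H$ are understood for densities with values in $\mathbb{E}$ a.e. Mean-field game system: $-u-H(x,Du,D^2u,m,h(m))=0$ and $m-\operatorname{div}(mD_pH(x,Du,D^2u,m,h(m)))+(mD_{M_{ij}}H(x,Du,D^2u,m,h(m)))_{x_ix_j}=1$ on $\mathbb{T}^d$.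 Operator $A$ and weak solutions. For $(\eta,v)\in C^\infty(\mathbb{T}^d;\mathbb{E})\times C^\infty(\mathbb{T}^d)$, $A(\eta,v)$ is the pair with components $-v-H(x,Dv,D^2v,\eta,h(\eta))$ and $\eta-\operatorname{div}(\eta D_pH(x,Dv,D^2v,\eta,h(\eta)))+(\eta D_{M_{ij}}H(x,Dv,D^2v,\eta,h(\eta)))_{x_ix_j}-1$. A pair $(m,u)\in\mathcal{D}'(\mathbb{T}^d)\times\mathcal{D}'(\mathbb{T}^d)$ with $m\ge0$ is a weak solution of the mean-field game system if $\langle(\eta,v)-(m,u),A(\eta,v)\rangle\ge0$ for all $(\eta,v)\in C^\infty(\mathbb{T}^d;\mathbb{E})\times C^\infty(\mathbb{T}^d)$ (distributional duality). Regularized system. Fix $N\in\mathbb{N}$ with $2N-4>\frac d2+1$ and $q>d$; for each $\epsilon_1\in(0,1)$, $\beta_{\epsilon_1}:(0,\infty)\to(-\infty,0]$ is a fixed non-decreasing $C^\infty$ function with $\beta_{\epsilon_1}(s)=0$ for $s\ge\epsilon_1$ and $\beta_{\epsilon_1}(s)=-s^{-q}$ for $0<s\le\epsilon_1/2$. For $\epsilon=(\epsilon_1,\epsilon_2)\in(0,1)^2$, $D(A^\epsilon)=\{(m,u)\in W^{4N,2}(\mathbb{T}^d)\times W^{4N,2}(\mathbb{T}^d):\inf_{\mathbb{T}^d}m>0\}$ and the regularized system is $$\begin{cases}-u-H+\epsilon_1(m+\Delta^{2N}m)+\epsilon_2(m-\Delta m)+\beta_{\epsilon_1}(m)=0,\\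 m-\operatorname{div}(mD_pH)+(mD_{M_{ij}}H)_{x_ix_j}-1+\epsilon_1(u+\Delta^{2N}u)+\epsilon_2(u-\Delta u)=0,\end{cases}$$ with $H$ and derivatives evaluated at $(x,Du,D^2u,m,h(m))$. (h-regularity) For all $\kappa>\frac d2+1$: $h(m)\in W^{\kappa,2}(\mathbb{T}^d)$ for every $m\in W^{\kappa,2}(\mathbb{T}^d)$ ($m\geq 0$), and $m\mapsto h(m)$ is a Fréchet differentiable map from (nonnegative elements of) $W^{\kappa,2}(\mathbb{T}^d)$ to $W^{\kappa,2}(\mathbb{T}^d)$. (g-structure) (1) There are functions $g_1,g_2$ with $g=g_1+g_2$ on $\mathbb{T}^d\times\mathbb{E}\times\mathbb{R}$ and $g_2(x,m(x),h(m)(x))\ge0$ for all $m\in\mathcal{M}_{ac}(\mathbb{T}^d)$. (2) There is $c>0$ with $\int_{\mathbb{T}^d} g_2(x,m,h(m))\,dx\le c\,(1+\int_{\mathbb{T}^d} m\,dx)$ for all $m\in\mathcal{M}_{ac}(\mathbb{T}^d)$. (3) For all $\delta>0$ there is $C_\delta>0$ with $\max\{\int_{\mathbb{T}^d} g_1(x,m,h(m))\,dx,\int_{\mathbb{T}^d} m\,dx\}\le\delta\int_{\mathbb{T}^d} m g_1(x,m,h(m))\,dx+C_\delta$ for all $m\in\mathcal{M}_{ac}(\mathbb{T}^d)$. (4) There is $R\ge0$ with $\int_{\mathbb{T}^d} mg_1(x,m,h(m))\,dx\ge-R$ for all $m\in\mathcal{M}_{ac}(\mathbb{T}^d)$. (g-compactness)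 If $(m_j)\subset\mathcal{M}_{ac}(\mathbb{T}^d)$ and $\sup_j\int_{\mathbb{T}^d} m_jg_1(x,m_j,h(m_j))\,dx<+\infty$, then a subsequence of $(m_j)$ converges weakly in $L^1(\mathbb{T}^d)$. (H-growth) There are constants $\gamma>1$, $0\le\tau<1$, $C_1,C_2,C_3,C_4>0$ such that, with the given continuous function $g:\mathbb{T}^d\times\mathbb{E}\times\mathbb{R}\to\mathbb{R}$ (the same $g=g_1+g_2$ as in (g-structure)): (a) for all $(x,p,M,m,\theta)$, $-H+D_pH\cdot p+D_MH:M\ge\frac1{C_1}m^{-\tau}|p|^\gamma+C_2g(x,m,\theta)-C_1$, with $H$ and derivatives evaluated at $(x,p,M,m,\theta)$; (b) for all $(m,u)\in\mathcal{M}_{ac}(\mathbb{T}^d)\times W^{1,\gamma}(\mathbb{T}^d)$ with $D^2u$ a measurable function, $$-C_3\int_{\mathbb{T}^d} g(x,m,h(m))dx+\frac1{C_1}\int_{\mathbb{T}^d}|Du|^\gamma m^{-\tau}dx-C_1\le\int_{\mathbb{T}^d} H(x,Du,D^2u,m,h(m))dx\le-C_4\int_{\mathbb{T}^d} g(x,m,h(m))dx+C_1\Big(1+\int_{\mathbb{T}^d}|Du|^\gamma m^{-\tau}dx\Big).$$ (H-smoothness) $H$ is of class $C^\infty$ on $\mathbb{T}^d\times\mathbb{R}^d\times\mathbb{R}^{d\times d}\times\mathbb{E}\times\mathbb{R}$. (monotonicity) For all $(\eta,v),(\bar\eta,\bar v)\in C^\infty(\mathbb{T}^d;\mathbb{E})\times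 C^\infty(\mathbb{T}^d)$, $\big(A(\eta,v)-A(\bar\eta,\bar v),(\eta,v)-(\bar\eta,\bar v)\big)_{L^2(\mathbb{T}^d)\times L^2(\mathbb{T}^d)}\ge0$. (degenerate structure with lower semicontinuity) $H(x,p,M,m,\theta)=H_0(x,p,m,\theta)-\sum_{i,j=1}^da_{ij}(x)M_{ij}$, where $H_0$ is a real-valued $C^\infty$ function and $(a_{ij})_{1\le i,j\le d}$ is a $C^\infty$ matrix-valued function on $\mathbb{T}^d$; and for all $\varphi\in C^\infty(\mathbb{T}^d)$ with $\varphi\ge0$ the functional $(m,u)\in L^1(\mathbb{T}^d)\times W^{1,\gamma}(\mathbb{T}^d)\mapsto\int_{\mathbb{T}^d}\varphi\,H_0(x,Du,m,h(m))\,dx$ (with $m\ge 0$) is sequentially weakly lower semicontinuous in $L^1(\mathbb{T}^d)\times W^{1,\gamma}(\mathbb{T}^d)$. *)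

(* Defs.v *)
From HB Require Import structures.
From mathcomp Require Import all_boot all_order all_algebra.
From mathcomp Require Import all_classical all_reals all_analysis.

Set Implicit Arguments.
Unset Strict Implicit.
Unset Printing Implicit Defensive.

Import Order.TTheory GRing.Theory Num.Def Num.Theory.
Import numFieldNormedType.Exports.

Local Open Scope classical_set_scope.
Local Open Scope ring_scope.

(* Functions on the torus R^d / Z^d are Z^d-periodic functions on 'rV[R]_d;
   they are integrated over the unit cube. *)

Section cube_measure.
Context (R : realType).

Definition cons_pair n (z : measurableTypeR R * n.-tuple (measurableTypeR R)) :
  n.+1.-tuple (measurableTypeR R) := [the n.+1.-tuple _ of z.1 :: z.2].

Lemma measurable_cons_pair n : measurable_fun [set: _] (@cons_pair n).
Proof. exact: measurable_cons. Qed.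

HB.instance Definition _ n := isMeasurableFun.Build _ _ _ _ (@cons_pair n)
  (@measurable_cons_pair n).

(* Lebesgue measure on the unit cube of R^n, as an n-fold product: the uniform
   probability on [0, 1] is Lebesgue measure restricted to [0, 1]. *)
Fixpoint cube_measure n : probability (n.-tuple (measurableTypeR R)) R :=
  match n with
  | 0 => dirac [tuple]
  | n'.+1 =>
      distribution (uniform_prob (@ltr01 R) \x cube_measure n')%E (@cons_pair n')
  end.

End cube_measure.

Section torus.
Context (R : realType) (d : nat).
Implicit Types (f u v w m eta phi : 'rV[R]_d -> R) (s : seq 'I_d).

Definition unit_vec (i : 'I_d) : 'rV[R]_d := delta_mx 0 i.

Definition vec_of_tuple (t : d.-tuple (measurableTypeR R)) : 'rV[R]_d :=
  \row_i tnth t i.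

Definition torus_periodic (U : Type) (f : 'rV[R]_d -> U) :=
  forall x i, f (x + unit_vec i) = f x.

Definition ae_torus (P : 'rV[R]_d -> Prop) :=
  \forall t \ae cube_measure R d, P (vec_of_tuple t).

Definition eint_torus (F : 'rV[R]_d -> \bar R) : \bar R :=
  (\int[cube_measure R d]_t F (vec_of_tuple t))%E.

Definition int_torus f : R := \int[cube_measure R d]_t f (vec_of_tuple t).

(* The integral of f over the torus exists in [-oo, +oo]; outside this case
   eint_torus is a default value.  Functions are measurable in the sense of
   Lebesgue, i.e., almost everywhere equal to a Borel function. *)
Definition has_integral f :=
  exists2 b : d.-tuple (measurableTypeR R) -> R,
    measurable_fun [set: _] b /\
    \forall t \ae cube_measure R d, f (vec_of_tuple t) = b t &
    (\int[cube_measure R d]_t ((EFin \o b)^\+ t) < +oo)%E \/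
    (\int[cube_measure R d]_t ((EFin \o b)^\- t) < +oo)%E.

Definition Lp (p : R) f :=
  torus_periodic f /\
  exists2 b : d.-tuple (measurableTypeR R) -> R,
    b \in Lfun (cube_measure R d) p%:E &
    \forall t \ae cube_measure R d, f (vec_of_tuple t) = b t.

Definition Lp_norm (p : R) f : R :=
  fine (Lnorm (cube_measure R d) p%:E (fun t => (f (vec_of_tuple t))%:E)).

End torus.

Section smooth.
Context (R : realType).

(* Iterated directional derivatives; on a finite-dimensional space, C^oo means
   that all of them exist and are continuous. *)
Definition iter_derive (V : normedModType R) (s : seq V) (f : V -> R) : V -> R :=
  foldr (fun v g => 'D_v g) f s.

Definition smooth_on (V : normedModType R) (U : set V) (f : V -> R) :=
  forall (s : seq V) x, U x ->
    {for x, continuous (iter_derive s f)} /\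
    forall v, derivable (iter_derive s f) x v.

(* Smoothness on a set that need not be open (needed when E = [0, +oo)). *)
Definition smooth_up_to (V : normedModType R) (D : set V) (f : V -> R) :=
  exists (U : set V) (F : V -> R),
    [/\ open U, D `<=` U, smooth_on U F & {in D, F =1 f}].

Context (d : nat).
Implicit Types (f v : 'rV[R]_d -> R).

Definition smooth_torus f := torus_periodic f /\ smooth_on setT f.

Definition partials (s : seq 'I_d) : ('rV[R]_d -> R) -> 'rV[R]_d -> R :=
  iter_derive (map (@unit_vec R d) s).

Definition grad v (x : 'rV[R]_d) : 'rV[R]_d := \row_i partials [:: i] v x.

Definition hess v (x : 'rV[R]_d) : 'M[R]_d :=
  \matrix_(i, j) partials [:: i; j] v x.

Definition dotv (p q : 'rV[R]_d) : R := \sum_i p 0 i * q 0 i.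

Definition enorm (p : 'rV[R]_d) : R := Num.sqrt (dotv p p).

Definition mx_contract (A B : 'M[R]_d) : R := \sum_i \sum_j A i j * B i j.

End smooth.

Section sobolev.
Context (R : realType) (d : nat).
Implicit Types (f u v w m eta phi : 'rV[R]_d -> R) (s : seq 'I_d).

(* Multi-indices are lists of coordinates, of order [size s]. *)
Definition is_weak_deriv s u w :=
  [/\ Lp 1 u, Lp 1 w &
    forall phi, smooth_torus phi ->
      int_torus (fun x => u x * partials s phi x) =
      (-1) ^+ size s * int_torus (fun x => w x * phi x)].

(* A version of the weak derivative, when there is one. *)
Definition weak_deriv s u : 'rV[R]_d -> R :=
  if nilp s then u else xget (fun=> 0) [set w | is_weak_deriv s u w].

Definition has_weak_deriv s u := exists w, is_weak_deriv s u w.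

Definition wgrad u (x : 'rV[R]_d) : 'rV[R]_d :=
  \row_i weak_deriv [:: i] u x.

Definition whess u (x : 'rV[R]_d) : 'M[R]_d :=
  \matrix_(i, j) weak_deriv [:: i; j] u x.

Definition wlaplacian u (x : 'rV[R]_d) : R :=
  \sum_i weak_deriv [:: i; i] u x.

(* A space of (representatives of) functions with its norm. *)
Record fspace := FSpace {
  fmem : set ('rV[R]_d -> R);
  fnorm : ('rV[R]_d -> R) -> R }.

Definition Lp_space (p : R) : fspace := FSpace (Lp p) (Lp_norm p).

Definition W_space (k : nat) (p : R) : fspace :=
  FSpace
    [set u | forall s, (size s <= k)%N ->
       Lp p (weak_deriv s u) /\ is_weak_deriv s u (weak_deriv s u)]
    (fun u => \sum_(j < k.+1) \sum_(s : j.-tuple 'I_d) Lp_norm p (weak_deriv s u)).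

Definition bounded_functional (V : fspace) (l : ('rV[R]_d -> R) -> R) :=
  (forall (a : R) u v, fmem V u -> fmem V v ->
     l (fun x => a * u x + v x) = a * l u + l v) /\
  exists C, forall u, fmem V u -> `|l u| <= C * fnorm V u.

Definition weak_cvg (V : fspace) (un : nat -> 'rV[R]_d -> R) u :=
  [/\ forall n, fmem V (un n), fmem V u &
    forall l, bounded_functional V l -> l (un n) @[n --> \oo] --> l u].

Definition bounded_linear (V W : fspace)
    (L : ('rV[R]_d -> R) -> ('rV[R]_d -> R)) :=
  [/\ forall u, fmem V u -> fmem W (L u),
    forall (a : R) u v, fmem V u -> fmem V v ->
      ae_torus (fun x => L (fun y => a * u y + v y) x = a * L u x + L v x) &
    exists C, forall u, fmem V u -> fnorm W (L u) <= C * fnorm V u].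

(* Frechet differentiability relative to the set D. *)
Definition frechet_on (V W : fspace) (D : set ('rV[R]_d -> R))
    (F : ('rV[R]_d -> R) -> ('rV[R]_d -> R)) :=
  forall m, D m -> exists2 L, bounded_linear V W L &
    forall e, 0 < e -> exists2 del, 0 < del &
      forall m', D m' -> fnorm V (m' \- m) <= del ->
        fnorm W (F m' \- F m \- L (m' \- m)) <= e * fnorm V (m' \- m).

Definition ae_nonneg f := ae_torus (fun x => 0 <= f x).

(* Densities of the measures in M_ac. *)
Definition Mac m := Lp 1 m /\ ae_nonneg m.

(* Densities with values in E almost everywhere. *)
Definition MacE (E : set R) m := Mac m /\ ae_torus (fun x => E (m x)).

Definition smoothE (E : set R) eta := smooth_torus eta /\ forall x, E (eta x).

(* Distributions on the torus. *)
Definition distribution_torus (T : ('rV[R]_d -> R) -> R) :=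
  (forall (a : R) phi psi, smooth_torus phi -> smooth_torus psi ->
     T (fun x => a * phi x + psi x) = a * T phi + T psi) /\
  exists C (k : nat), forall phi (B : R), smooth_torus phi ->
    (forall s x, (size s <= k)%N -> `|partials s phi x| <= B) ->
    `|T phi| <= C * B.

Definition regular_distribution f : ('rV[R]_d -> R) -> R :=
  fun phi => int_torus (fun x => f x * phi x).

End sobolev.

Section mean_field_game.
Context (R : realType) (d : nat) (E : set R).
Context (H : 'rV[R]_d -> 'rV[R]_d -> 'M[R]_d -> R -> R -> R).
Context (h : ('rV[R]_d -> R) -> ('rV[R]_d -> R)).
Implicit Types (u v m eta phi : 'rV[R]_d -> R).

Definition DpH x p M mu theta : 'rV[R]_d :=
  \row_i 'D_(unit_vec R i) (fun q => H x q M mu theta) p.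

Definition DMH x p M mu theta : 'M[R]_d :=
  \matrix_(i, j) 'D_(delta_mx i j) (fun Q => H x p Q mu theta) M.

Definition operator_valid :=
  (forall m, Mac m -> torus_periodic (h m) /\ continuous (h m)) /\
  forall m m', Mac m -> Mac m' -> ae_torus (fun x => m x = m' x) -> h m = h m'.

Definition A1 eta v (x : 'rV[R]_d) : R :=
  - v x - H x (grad v x) (hess v x) (eta x) (h eta x).

Definition A2 eta v (x : 'rV[R]_d) : R :=
  eta x
  - \sum_i partials [:: i] (fun y =>
      eta y * DpH y (grad v y) (hess v y) (eta y) (h eta y) 0 i) x
  + \sum_i \sum_j partials [:: i; j] (fun y =>
      eta y * DMH y (grad v y) (hess v y) (eta y) (h eta y) i j) x
  - 1.

Definition weak_solution (m u : ('rV[R]_d -> R) -> R) :=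
  [/\ distribution_torus m, distribution_torus u,
    forall phi, smooth_torus phi -> (forall x, 0 <= phi x) -> 0 <= m phi &
    forall eta v, smoothE E eta -> smooth_torus v ->
      0 <= (int_torus (fun x => eta x * A1 eta v x) - m (A1 eta v))
         + (int_torus (fun x => v x * A2 eta v x) - u (A2 eta v))].

Definition monotonicity :=
  forall eta v eta' v', smoothE E eta -> smooth_torus v ->
    smoothE E eta' -> smooth_torus v' ->
    0 <= int_torus (fun x => (A1 eta v x - A1 eta' v' x) * (eta x - eta' x))
       + int_torus (fun x => (A2 eta v x - A2 eta' v' x) * (v x - v' x)).

Definition h_regularity :=
  forall k : nat, d%:R / 2 + 1 < k%:R :> R ->
    let S := [set m | fmem (W_space d k 2) m /\ ae_nonneg m] in
    (forall m, S m -> fmem (W_space d k 2) (h m)) /\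
    frechet_on (W_space d k 2) (W_space d k 2) S h.

Definition H_smoothness :=
  smooth_up_to
    [set z : 'rV[R]_d * 'rV[R]_d * 'M[R]_d * R * R | E z.1.2]
    (fun z => H z.1.1.1.1 z.1.1.1.2 z.1.1.2 z.1.2 z.2).

(* Regularized system; beta is the family e1 |-> beta_e1. *)

Definition penalization (q : R) (beta : R -> R -> R) :=
  forall e1, 0 < e1 < 1 ->
    [/\ {in [pred s | 0 < s] &, {homo beta e1 : s t / s <= t}},
        smooth_on [set s : R | 0 < s] (beta e1),
        forall s, 0 < s -> beta e1 s <= 0,
        forall s, e1 <= s -> beta e1 s = 0 &
        forall s, 0 < s <= e1 / 2 -> beta e1 s = - s `^ (- q)].

Definition regularized_domain (N : nat) m u :=
  [/\ fmem (W_space d (4 * N) 2) m, fmem (W_space d (4 * N) 2) u &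
    exists2 c, 0 < c & ae_torus (fun x => c <= m x)].

Definition regularized_solution (N : nat) (beta : R -> R -> R) (e1 e2 : R) m u :=
  let DpHmu i x :=
    m x * DpH x (wgrad u x) (whess u x) (m x) (h m x) 0 i in
  let DMHmu i j x :=
    m x * DMH x (wgrad u x) (whess u x) (m x) (h m x) i j in
  [/\ regularized_domain N m u,
    ae_torus (fun x =>
      - u x - H x (wgrad u x) (whess u x) (m x) (h m x)
      + e1 * (m x + iter (2 * N) (@wlaplacian R d) m x)
      + e2 * (m x - wlaplacian m x) + beta e1 (m x) = 0),
    forall i, has_weak_deriv [:: i] (DpHmu i),
    forall i j, has_weak_deriv [:: i; j] (DMHmu i j) &
    ae_torus (fun x =>
      m x - \sum_i weak_deriv [:: i] (DpHmu i) x
      + \sum_i \sum_j weak_deriv [:: i; j] (DMHmu i j) x - 1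
      + e1 * (u x + iter (2 * N) (@wlaplacian R d) u x)
      + e2 * (u x - wlaplacian u x) = 0)].

End mean_field_game.

Section growth.
Context (R : realType) (d : nat) (E : set R).
Context (H : 'rV[R]_d -> 'rV[R]_d -> 'M[R]_d -> R -> R -> R).
Context (h : ('rV[R]_d -> R) -> ('rV[R]_d -> R)).
Implicit Types (u m phi : 'rV[R]_d -> R) (g : 'rV[R]_d -> R -> R -> R).

Definition g_continuous g :=
  (forall mu theta, torus_periodic (fun x => g x mu theta)) /\
  {within [set z : 'rV[R]_d * R * R | E z.1.2],
    continuous (fun z : 'rV[R]_d * R * R => g z.1.1 z.1.2 z.2)}.

Definition comp_g g m (x : 'rV[R]_d) : R := g x (m x) (h m x).

(* Integrals of functions of m live in [-oo, +oo]; a non-existing integral is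
   -oo in eint_torus, so the last clause asserts existence. *)
Definition g_structure g g1 g2 :=
  [/\ [/\ forall mu theta, torus_periodic (fun x => g1 x mu theta),
          forall mu theta, torus_periodic (fun x => g2 x mu theta),
          forall x mu theta, E mu ->
            g x mu theta = g1 x mu theta + g2 x mu theta &
          forall m, MacE E m -> ae_torus (fun x => 0 <= comp_g g2 m x)],
    (exists2 c : R, (0 < c)%R & forall m, MacE E m ->
       eint_torus (fun x => (comp_g g2 m x)%:E)
       <= c%:E * (1 + eint_torus (fun x => (m x)%:E)))%E,
    (forall del : R, (0 < del)%R -> exists2 C : R, (0 < C)%R &
       forall m, MacE E m ->
       maxe (eint_torus (fun x => (comp_g g1 m x)%:E))
            (eint_torus (fun x => (m x)%:E))
       <= del%:E * eint_torus (fun x => (m x * comp_g g1 m x)%:E) + C%:E)%E &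
    (exists2 r : R, (0 <= r)%R & forall m, MacE E m ->
       - r%:E <= eint_torus (fun x => (m x * comp_g g1 m x)%:E))%E].

Definition g_compactness g1 :=
  forall mj : nat -> 'rV[R]_d -> R, (forall j, MacE E (mj j)) ->
    (ereal_sup (range (fun j =>
       eint_torus (fun x => (mj j x * comp_g g1 (mj j) x)%:E))) < +oo)%E ->
    exists (k : nat -> nat) m,
      {homo k : i j / (i < j)%N} /\ weak_cvg (Lp_space d 1) (mj \o k) m.

(* |p|^gamma m^(-tau), with 0^(-tau) = +oo for tau > 0 and 0 * +oo = 0. *)
Definition congestion (gamma tau : R) (p : 'rV[R]_d) (mu : R) : \bar R :=
  ((enorm p `^ gamma)%:E *
   (if (mu == 0%R) && (0 < tau)%R then +oo else (mu `^ (- tau))%:E))%E.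

(* In the integral bounds, inequalities are required when the integrals of g
   and H exist and their outer members are not of the form oo - oo. *)
Definition H_growth g (gamma : R) :=
  1 < gamma /\
  exists tau C1 C2 C3 C4 : R,
  [/\ 0 <= tau < 1, [/\ 0 < C1, 0 < C2, 0 < C3 & 0 < C4],
    (forall x p M mu theta, E mu ->
       (C1^-1)%:E * congestion gamma tau p mu
         + (C2 * g x mu theta - C1)%:E
       <= (- H x p M mu theta + dotv (DpH H x p M mu theta) p
             + mx_contract (DMH H x p M mu theta) M)%:E)%E &
    forall m u, MacE E m -> fmem (W_space d 1 gamma) u ->
      (forall i j, has_weak_deriv [:: i; j] u) ->
      let Hmu x := H x (wgrad u x) (whess u x) (m x) (h m x) in
      let Ig := eint_torus (fun x => (comp_g g m x)%:E) in
      let Ip := eint_torus (fun x => congestion gamma tau (wgrad u x) (m x)) in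
      let IH := eint_torus (fun x => (Hmu x)%:E) in
      has_integral (comp_g g m) -> has_integral Hmu ->
      ~ (Ig = +oo%E /\ Ip = +oo%E) ->
      ((- (C3%:E * Ig) + (C1^-1)%:E * Ip - C1%:E <= IH) /\
       (IH <= - (C4%:E * Ig) + C1%:E * (1 + Ip)))%E].

Definition comp_H0 (H0 : 'rV[R]_d -> 'rV[R]_d -> R -> R -> R) m u
    (x : 'rV[R]_d) : R := H0 x (wgrad u x) (m x) (h m x).

(* If E = (0, +oo), then E-valued densities may converge weakly to one that
   vanishes on a set of positive measure; H0 is accordingly a function on
   [0, +oo) in the variable m, smooth on E, whose values at m = 0 matter only
   through the functional below. *)
Definition degenerate_lsc (H0 : 'rV[R]_d -> 'rV[R]_d -> R -> R -> R)
    (a : 'rV[R]_d -> 'M[R]_d) (gamma : R) :=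
  [/\ (forall x p M mu theta, E mu ->
         H x p M mu theta = H0 x p mu theta - mx_contract (a x) M),
    (forall p mu theta, torus_periodic (fun x => H0 x p mu theta)) /\
    smooth_up_to [set z : 'rV[R]_d * 'rV[R]_d * R * R | E z.1.2]
      (fun z => H0 z.1.1.1 z.1.1.2 z.1.2 z.2),
    (forall i j, smooth_torus (fun x => a x i j)) &
    forall phi, smooth_torus phi -> (forall x, 0 <= phi x) ->
      (forall m u, Mac m -> fmem (W_space d 1 gamma) u ->
         has_integral (fun x => phi x * comp_H0 H0 m u x)) /\
      (forall (mn un : nat -> 'rV[R]_d -> R) m u,
         (forall n, MacE E (mn n)) -> Mac m ->
         weak_cvg (Lp_space d 1) mn m ->
         weak_cvg (W_space d 1 gamma) un u ->
         (eint_torus (fun x => (phi x * comp_H0 H0 m u x)%:E) <=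
          limn_einf (fun n =>
            eint_torus (fun x => (phi x * comp_H0 H0 (mn n) (un n) x)%:E)))%E)].

End growth.

(* Main.v *)
(* Since the penalization is nonpositive and H = H0 - a : M, the first equation
   of the regularized system gives, for n the index of the sequence,
     phi (u_n + H0_n) <= phi (a : D^2 u_n) + e1 phi (m_n + Delta^(2N) m_n)
                         + e2 phi (m_n - Delta m_n)   a.e.
   After integration every derivative is moved onto smooth functions, so the
   right-hand side is a combination of integrals of u_n and m_n against fixed
   smooth functions.  These converge by weak convergence, and the terms with
   the factors e1, e2 vanish; no uniform estimate is needed.  The lower
   semicontinuity of the integral of phi H0 concludes. *)
Require Import Defs.
From HB Require Import structures.
From mathcomp Require Import all_boot all_order all_algebra.
From mathcomp Require Import all_classical all_reals all_analysis.
From mathcomp Require Import measurable_realfun ring lra.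

Set Implicit Arguments.
Unset Strict Implicit.
Unset Printing Implicit Defensive.

Import Order.TTheory GRing.Theory Num.Def Num.Theory.
Import numFieldNormedType.Exports.

Local Open Scope classical_set_scope.
Local Open Scope ring_scope.

(** * Integration up to almost everywhere equality *)

Section ae_integral.
Context d (T : measurableType d) (R : realType).
Context (mu : {measure set T -> \bar R}).
Import HBNNSimple.

(* No measurability is required: a simple function below [f] lies below [g]
   after being set to zero on a negligible set. *)
Lemma ae_ge0_le_integralT (f g : T -> \bar R) :
  (forall t, 0 <= f t)%E -> (forall t, 0 <= g t)%E ->
  (\forall t \ae mu, f t <= g t)%E ->
  (\int[mu]_t f t <= \int[mu]_t g t)%E.
Proof.
move=> f0 g0 [Z [mZ muZ fgZ]].
rewrite ge0_integralTE// ge0_integralTE//.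
apply: ge_ereal_sup => _ [k /= kf <-].
have mZc : measurable (~` Z) by exact: measurableC.
apply: ereal_sup_ubound; exists (proj_nnsfun k mZc) => /= [t|].
  rewrite mindicE; have [tZ|_] := boolP (t \in ~` Z); last by rewrite mulr0.
  rewrite mulr1; apply: le_trans (kf t) _; apply: contrapT => fgt.
  by move/set_mem : tZ; apply; exact: fgZ.
transitivity (\int[mu]_t (proj_nnsfun k mZc t)%:E)%E.
  by rewrite integral_nnsfun// patch_setT.
transitivity (\int[mu]_t (k t)%:E)%E; last first.
  by rewrite integral_nnsfun// patch_setT.
apply: ge0_ae_eq_integral => //.
- by apply/measurable_EFinP; exact: measurable_funP.
- by apply/measurable_EFinP; exact: measurable_funP.
- by move=> t _; rewrite lee_fin; exact: fun_ge0.
- by move=> t _; rewrite lee_fin; exact: fun_ge0.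
exists Z; split=> // t /= kt; apply: contrapT => tZ; apply: kt => _.
by rewrite /= mindicE mem_set// mulr1.
Qed.

(** The positive parts increase and the negative parts decrease; the difference stays monotone in
    [\bar R], where [+oo - +oo] is [-oo], so infinite parts are covered. *)
Lemma ae_le_integralT (f g : T -> \bar R) :
  (\forall t \ae mu, f t <= g t)%E ->
  (\int[mu]_t f t <= \int[mu]_t g t)%E.
Proof.
move=> fg; rewrite integralE [leRHS]integralE.
apply: leeB; apply: ae_ge0_le_integralT => //.
  by apply: filterS fg => t fgt; rewrite !funeposE ge_max !le_max fgt lexx orbT.
apply: filterS fg => t fgt.
by rewrite !funenegE ge_max !le_max leeN2 fgt lexx orbT.
Qed.

Lemma ae_eq_integralT (f g : T -> \bar R) :
  (\forall t \ae mu, f t = g t) -> (\int[mu]_t f t = \int[mu]_t g t)%E.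
Proof.
move=> fg; apply/eqP; rewrite eq_le !ae_le_integralT//;
  by apply: filterS fg => t ->.
Qed.

(** Lebesgue integrability over a Borel structure: [f] itself, for instance a chosen version of a
    weak derivative, is measurable only through the representative [b]. *)
Definition ae_integrable (f : T -> R) :=
  exists2 b, mu.-integrable setT (EFin \o b) & \forall t \ae mu, f t = b t.

Lemma eq_ae_integrable f g :
  (\forall t \ae mu, f t = g t) -> ae_integrable f -> ae_integrable g.
Proof.
move=> fg [b ib fb]; exists b => //.
by apply: filterS2 fg fb => t -> ->.
Qed.

Lemma ae_eq_Rintegral f g : (\forall t \ae mu, f t = g t) ->
  \int[mu]_t f t = \int[mu]_t g t.
Proof.
move=> fg; congr fine; apply: ae_eq_integralT.
by apply: filterS fg => t ->.
Qed.

(** The real integral is [fine] of the extended one; integrability of the representative excludes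
    the infinite values, which [fine] sends to 0. *)
Lemma ae_integrable_EFin f : ae_integrable f ->
  (\int[mu]_t (f t)%:E = (\int[mu]_t f t)%:E)%E.
Proof.
move=> [b ib fb]; rewrite (ae_eq_Rintegral fb).
rewrite (@ae_eq_integralT _ (EFin \o b)); last by apply: filterS fb => t ->.
by rewrite fineK//; exact: integrable_fin_num.
Qed.

Let integrableZl_EFin a (b : T -> R) : mu.-integrable setT (EFin \o b) ->
  mu.-integrable setT (EFin \o (fun t => a * b t)).
Proof.
move=> ib; rewrite (_ : _ \o _ = (fun t => a%:E * (EFin \o b) t)%E).
  exact: integrableZl.
by apply/funext => t /=; rewrite EFinM.
Qed.

Lemma ae_integrable_cst0 : ae_integrable (fun=> 0).
Proof. by exists (fun=> 0); [exact: integrable0|exact: filterE]. Qed.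

Lemma ae_integrable_lin a f g : ae_integrable f -> ae_integrable g ->
  ae_integrable (fun t => a * f t + g t).
Proof.
move=> [b ib fb] [c ic gc]; exists (fun t => a * b t + c t).
  have iab : mu.-integrable setT (EFin \o (fun t => a * b t)).
    exact: (integrableZl_EFin a ib).
  exact: (integrableD measurableT iab ic).
by apply: filterS2 fb gc => t -> ->.
Qed.

Lemma Rintegral_lin a f g : ae_integrable f -> ae_integrable g ->
  \int[mu]_t (a * f t + g t) = a * \int[mu]_t f t + \int[mu]_t g t.
Proof.
move=> [b ib fb] [c ic gc].
rewrite (ae_eq_Rintegral fb) (ae_eq_Rintegral gc).
rewrite (@ae_eq_Rintegral _ (fun t => a * b t + c t)); last first.
  by apply: filterS2 fb gc => t -> ->.
rewrite RintegralD//; first by rewrite RintegralZl.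
exact: (integrableZl_EFin a ib).
Qed.

Lemma ae_integrableZ a f : ae_integrable f -> ae_integrable (fun t => a * f t).
Proof.
move=> intf.
apply: eq_ae_integrable (ae_integrable_lin a intf ae_integrable_cst0).
by apply: filterE => t; rewrite addr0.
Qed.

Lemma ae_integrableD f g : ae_integrable f -> ae_integrable g ->
  ae_integrable (fun t => f t + g t).
Proof.
move=> intf intg; apply: eq_ae_integrable (ae_integrable_lin 1 intf intg).
by apply: filterE => t; rewrite mul1r.
Qed.

Lemma ae_integrableB f g : ae_integrable f -> ae_integrable g ->
  ae_integrable (fun t => f t - g t).
Proof.
move=> intf intg; apply: eq_ae_integrable (ae_integrable_lin (-1) intg intf).
by apply: filterE => t; rewrite mulN1r addrC.
Qed.

Lemma RintegralZ_ae a f : ae_integrable f ->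
  \int[mu]_t (a * f t) = a * \int[mu]_t f t.
Proof.
move=> intf; under eq_Rintegral do rewrite -[a * _]addr0.
rewrite (Rintegral_lin a intf ae_integrable_cst0) Rintegral_cst// mul0r.
by rewrite addr0.
Qed.

Lemma RintegralD_ae f g : ae_integrable f -> ae_integrable g ->
  \int[mu]_t (f t + g t) = \int[mu]_t f t + \int[mu]_t g t.
Proof.
move=> intf intg; under eq_Rintegral do rewrite -[f _]mul1r.
by rewrite Rintegral_lin// mul1r.
Qed.

Lemma RintegralB_ae f g : ae_integrable f -> ae_integrable g ->
  \int[mu]_t (f t - g t) = \int[mu]_t f t - \int[mu]_t g t.
Proof.
move=> intf intg; under eq_Rintegral do rewrite addrC -[- _]mulN1r.
by rewrite Rintegral_lin// mulN1r addrC.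
Qed.

Lemma ae_integrable_sum (I : Type) (r : seq I) (F : I -> T -> R) :
  (forall i, ae_integrable (F i)) ->
  ae_integrable (fun t => \sum_(i <- r) F i t).
Proof.
move=> intF; elim: r => [|i r IH].
  by under eq_fun do rewrite big_nil; exact: ae_integrable_cst0.
by under eq_fun do rewrite big_cons; exact: ae_integrableD.
Qed.

Lemma Rintegral_sum_ae (I : Type) (r : seq I) (F : I -> T -> R) :
  (forall i, ae_integrable (F i)) ->
  \int[mu]_t (\sum_(i <- r) F i t) = \sum_(i <- r) \int[mu]_t F i t.
Proof.
move=> intF; elim: r => [|i r IH].
  under eq_Rintegral do rewrite big_nil.
  by rewrite big_nil Rintegral_cst// mul0r.
under eq_Rintegral do rewrite big_cons.
by rewrite big_cons -IH RintegralD_ae//; exact: ae_integrable_sum.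
Qed.

Let integrableM_bounded (b k : T -> R) (C : R) : measurable_fun setT k ->
  (forall t, `|k t| <= C) -> mu.-integrable setT (EFin \o b) ->
  mu.-integrable setT (EFin \o (fun t => b t * k t)).
Proof.
move=> mk kC ib; have mb : measurable_fun setT b.
  exact/measurable_EFinP/(measurable_int mu).
apply: (@le_integrable _ _ _ mu setT measurableT _ (fun t => (C * b t)%:E)).
- by apply/measurable_EFinP; exact: measurable_funM.
- move=> t _ /=; rewrite lee_fin !normrM mulrC ler_wpM2r//.
  by apply: le_trans (kC t) _; exact: ler_norm.
- exact: (integrableZl_EFin C ib).
Qed.

Lemma ae_integrableM (f k : T -> R) (C : R) : measurable_fun setT k ->
  (forall t, `|k t| <= C) -> ae_integrable f ->
  ae_integrable (fun t => f t * k t).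
Proof.
move=> mk kC [b ib fb]; exists (fun t => b t * k t).
  exact: (integrableM_bounded mk kC ib).
by apply: filterS fb => t ->.
Qed.

(** This makes pairing with a bounded function continuous on L^1; the last factor is the form to
    which the L^1 norm of [f] unfolds. *)
Lemma norm_RintegralM (f k : T -> R) (C : R) : measurable_fun setT k ->
  (forall t, `|k t| <= C) -> ae_integrable f ->
  `|\int[mu]_t (f t * k t)| <= C * fine (\int[mu]_t `|(f t)%:E|)%E.
Proof.
move=> mk kC [b ib fb].
have iab : mu.-integrable setT (EFin \o (normr \o b)).
  exact: (integrable_norm ib).
have ibk := integrableM_bounded mk kC ib.
rewrite (@ae_eq_Rintegral _ (fun t => b t * k t)); last first.
  by apply: filterS fb => t ->.
rewrite (@ae_eq_integralT _ (EFin \o (normr \o b))); last first.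
  by apply: filterS fb => t ->.
apply: le_trans (le_normr_Rintegral measurableT ibk) _.
rewrite -[X in C * X]/(Rintegral mu setT (normr \o b)) -RintegralZl//.
apply: le_Rintegral => //.
- exact: (integrable_norm ibk).
- exact: (integrableZl_EFin C iab).
- by move=> t _ /=; rewrite normrM mulrC ler_wpM2r.
Qed.

End ae_integral.

(** * Measurability and boundedness of continuous periodic functions *)

Section continuous_periodic.
Context (R : realType) (d : nat).
Implicit Types (f k : 'rV[R]_d -> R).

(** Tuples carry the product sigma-algebra, row vectors a topology. An open set is a countable union
    of open boxes with rational endpoints, and the preimage of a box is a finite intersection of
    conditions on coordinates. *)
Lemma measurable_vec_of_tuple_open (U : set 'rV[R]_d) : open U ->
  measurable (@vec_of_tuple R d @^-1` U).
Proof.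
move=> oU.
pose box (p : 'rV[rat]_d * 'rV[rat]_d) : set 'rV[R]_d :=
  [set x | forall i, ratr (p.1 0 i) < x 0 i < ratr (p.2 0 i)].
(* Boxes not contained in [U] contribute the empty set, so the union runs over the countable type of
   all pairs of rational vectors. *)
pose F p : set (d.-tuple (measurableTypeR R)) :=
  if `[< box p `<=` U >] then @vec_of_tuple R d @^-1` box p else set0.
suff -> : @vec_of_tuple R d @^-1` U = \bigcup_p F p.
  apply: countable_bigcupT_measurable => [|p]; first exact: countableP.
  rewrite /F; case: ifPn => _; last exact: measurable0.
  rewrite (_ : _ @^-1` _ = \bigcap_(i in [set: 'I_d])
    ((fun t : d.-tuple (measurableTypeR R) => tnth t i) @^-1`
      `]ratr (p.1 0 i), ratr (p.2 0 i)[%classic)).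
    apply: fin_bigcap_measurable => // i _; rewrite -[X in measurable X]setTI.
    by apply: measurable_tnth => //; exact: measurable_itv.
  apply/seteqP; split=> t /= bt i => [_|].
    by have := bt i; rewrite mxE/= in_itv.
  by have := bt i I; rewrite mxE/= in_itv.
apply/seteqP; split=> [t Ut|t [p _]]; last first.
  by rewrite /F; case: asboolP => // pU /pU.
move: (oU); rewrite openE => /(_ _ Ut) /nbhs_ballP[e /= e0 eU].
set x := vec_of_tuple t in eU.
(* Endpoints within [e] of each coordinate keep the box inside the ball, balls of row vectors being
   taken coordinatewise. *)
have /choice[ql qlP] i : exists q : rat, ratr q \in `]x 0 i - e, x 0 i[.
  by apply: rat_in_itvoo; rewrite gtrBl.
have /choice[qr qrP] i : exists q : rat, ratr q \in `]x 0 i, x 0 i + e[.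
  by apply: rat_in_itvoo; rewrite ltrDl.
exists (\row_i ql i, \row_i qr i) => //; rewrite /F ifT.
  move=> i; rewrite !mxE -/(x 0 i).
  have := qlP i; have := qrP i.
  by rewrite !in_itv/= mxE => /andP[-> _] /andP[_ ->].
apply/asboolP => y /= xy; apply: eU; split=> // i j; rewrite ord1 /ball/=.
have := xy j; rewrite !mxE => /andP[y1 y2].
have := qlP j; have := qrP j; rewrite !in_itv/= => /andP[_ x2] /andP[x1 _].
rewrite distrC ltr_distl; apply/andP; split.
  by move: x1; rewrite mxE => x1; exact: lt_trans x1 y1.
by move: x2; rewrite mxE => x2; exact: lt_trans y2 x2.
Qed.

Lemma measurable_vec_of_tuple f : continuous f ->
  measurable_fun [set: d.-tuple (measurableTypeR R)] (f \o @vec_of_tuple R d).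
Proof.
move=> /continuousP cf.
apply: (measurability _ (RGenOInfty.measurableE R)) => _ [_ [a ->] <-].
rewrite setTI comp_preimage; apply: measurable_vec_of_tuple_open.
by apply: cf; rewrite set_itvE; exact: open_gt.
Qed.

Lemma torus_periodic_int f (z : 'I_d -> int) x : torus_periodic f ->
  f (x + \sum_i (z i)%:~R *: unit_vec R i) = f x.
Proof.
move=> pf.
have pn n i y : f (y + n%:R *: unit_vec R i) = f y.
  elim: n => [|n IH]; first by rewrite scale0r addr0.
  by rewrite -natr1 scalerDl scale1r addrA pf.
have pz n i y : f (y + n%:~R *: unit_vec R i) = f y.
  case: n => n; first exact: pn.
  by rewrite NegzE mulrNz scaleNr -[LHS](pn n.+1 i) pmulrn subrK.
elim: (index_enum _) => [|i s IH]; first by rewrite big_nil addr0.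
by rewrite big_cons addrCA addrC pz.
Qed.

(** By periodicity every value is attained on the closed unit cube, which is compact. *)
Lemma continuous_periodic_bounded f : torus_periodic f -> continuous f ->
  exists C, forall x, `|f x| <= C.
Proof.
move=> pf cf.
have cK : compact [set x : 'rV[R]_d | forall i, `[0, 1]%classic (x 0 i)].
  apply: (@rV_compact R d (fun=> `[0, 1]%classic)) => i.
  exact: segment_compact.
have /compact_bounded[M [_ /(_ (M + 1))]] :=
  continuous_compact (continuous_subspaceT cf) cK.
(* Boundedness provides every constant above [M], whence [M + 1]. *)
rewrite ltrDl ltr01 => /(_ isT) fM.
exists (M + 1) => x.
(* Subtracting the integer parts of the coordinates moves [x] into the cube. *)
rewrite -(torus_periodic_int (fun i => - Num.floor (x 0 i)) x pf).
apply: fM; apply: imageP => i.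
rewrite /= in_itv/= !mxE summxE (bigD1 i)//= big1 => [|j ji].
  rewrite !mxE !eqxx mulr1 addr0 mulrNz subr_ge0 lerBlDr.
  by have := floor_itv (x 0 i); rewrite intrD addrC => /andP[-> /ltW].
by rewrite !mxE eqxx/= eq_sym (negbTE ji) mulr0.
Qed.

End continuous_periodic.

(** * Sums and products of smooth functions *)

Section smooth_algebra.
Context (R : realType) (V : normedModType R).
Implicit Types (f k : V -> R) (n : nat).

(** A truncation of [smooth_on setT], for induction on the order. Derivatives of order [n.+1] exist
    but may be discontinuous. *)
Definition smooth_upto n f := forall s : seq V, (size s <= n)%N -> forall x,
  {for x, continuous (iter_derive s f)} /\
  forall v, derivable (iter_derive s f) x v.

Lemma smooth_uptoP f : smooth_on setT f <-> forall n, smooth_upto n f.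
Proof.
split=> [sf n s _ x|sf s x _]; first exact: sf.
exact: (sf (size s)).
Qed.

Lemma iter_derive_rcons s v f :
  iter_derive (rcons s v) f = iter_derive s ('D_v f).
Proof. by rewrite /iter_derive foldr_rcons. Qed.

(** The last vector of a list acts first on [f], so splitting a list at its end trades one order for
    one derivative, the form to which the rules of differentiation apply. *)
Lemma smooth_uptoS n f : smooth_upto n.+1 f <->
  [/\ continuous f, forall x v, derivable f x v &
      forall v, smooth_upto n ('D_v f)].
Proof.
split=> [sf|[cf df Df] s sn x].
  split=> [x|x|v s sn x]; [exact: (sf [::] _ x).1|exact: (sf [::] _ x).2|].
  by rewrite -iter_derive_rcons; apply: sf; rewrite size_rcons.
move: sn; case/lastP: s => [_|s v]; first by split; [exact: cf|exact: df].
by rewrite size_rcons ltnS iter_derive_rcons => sn; exact: Df.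
Qed.

Lemma smooth_upto0 f : smooth_upto 0 f <->
  continuous f /\ forall x v, derivable f x v.
Proof.
split=> [sf|[cf df] s]; last first.
  by rewrite leqn0 => /nilP-> x; split; [exact: cf|exact: df].
by split=> x; [exact: (sf [::] _ x).1|exact: (sf [::] _ x).2].
Qed.

Lemma smooth_upto_leq n m f : (n <= m)%N -> smooth_upto m f -> smooth_upto n f.
Proof. by move=> nm sf s sn; apply: sf; exact: leq_trans sn nm. Qed.

Lemma smooth_upto_continuous n f : smooth_upto n f -> continuous f.
Proof. by move=> sf x; have [] := sf [::] (leq0n _) x. Qed.

Lemma smooth_upto_derivable n f :
  smooth_upto n f -> forall x v, derivable f x v.
Proof. by move=> sf x; have [] := sf [::] (leq0n _) x. Qed.

Lemma smooth_uptoD n f k :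
  smooth_upto n f -> smooth_upto n k -> smooth_upto n (fun x => f x + k x).
Proof.
elim: n f k => [|n IH] f k sf sk;
  have [cf df] := conj (smooth_upto_continuous sf) (smooth_upto_derivable sf);
  have [ck dk] := conj (smooth_upto_continuous sk) (smooth_upto_derivable sk).
  apply/smooth_upto0; split=> x.
    by apply: continuousD; [exact: cf|exact: ck].
  by move=> v; exact: derivableD.
apply/smooth_uptoS; split=> [x|x v|v].
- by apply: continuousD; [exact: cf|exact: ck].
- exact: derivableD.
rewrite (_ : 'D_v _ = fun x => 'D_v f x + 'D_v k x).
  by apply: IH; [have /smooth_uptoS[] := sf|have /smooth_uptoS[] := sk].
by apply/funext => x; exact: deriveD.
Qed.

(** Leibniz's rule gives two products with one factor differentiated; all factors are smooth up to
    [n], the undifferentiated ones by weakening. *)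
Lemma smooth_uptoM n f k :
  smooth_upto n f -> smooth_upto n k -> smooth_upto n (fun x => f x * k x).
Proof.
elim: n f k => [|n IH] f k sf sk;
  have [cf df] := conj (smooth_upto_continuous sf) (smooth_upto_derivable sf);
  have [ck dk] := conj (smooth_upto_continuous sk) (smooth_upto_derivable sk).
  apply/smooth_upto0; split=> x.
    by apply: continuousM; [exact: cf|exact: ck].
  by move=> v; exact: derivableM.
apply/smooth_uptoS; split=> [x|x v|v].
- by apply: continuousM; [exact: cf|exact: ck].
- exact: derivableM.
rewrite (_ : 'D_v _ = fun x => f x * 'D_v k x + k x * 'D_v f x).
  have [/smooth_uptoS[_ _ Df] /smooth_uptoS[_ _ Dk]] := conj sf sk.
  by apply: smooth_uptoD; apply: IH => //; exact: smooth_upto_leq (leqnSn _) _.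
by apply/funext => x; exact: deriveM.
Qed.

Lemma smooth_upto_cst0 n : smooth_upto n (fun=> 0).
Proof.
elim: n => [|n IH].
  apply/smooth_upto0; split=> x; first exact: cst_continuous.
  by move=> v; exact: derivable_cst.
apply/smooth_uptoS; split=> [x|x v|v].
- exact: cst_continuous.
- exact: derivable_cst.
rewrite (_ : 'D_v _ = fun=> 0) //.
by apply/funext => x; exact: derive_cst.
Qed.

End smooth_algebra.

(** * Smooth functions on the torus and their derivatives *)

Section smooth_torus_algebra.
Context (R : realType) (d : nat).
Implicit Types (f k : 'rV[R]_d -> R) (s : seq 'I_d).

Lemma smooth_torusD f k : smooth_torus f -> smooth_torus k ->
  smooth_torus (fun x => f x + k x).
Proof.
move=> [pf /smooth_uptoP sf] [pk /smooth_uptoP sk]; split=> [x i|].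
  by rewrite pf pk.
by apply/smooth_uptoP => n; exact: smooth_uptoD.
Qed.

Lemma smooth_torusM f k : smooth_torus f -> smooth_torus k ->
  smooth_torus (fun x => f x * k x).
Proof.
move=> [pf /smooth_uptoP sf] [pk /smooth_uptoP sk]; split=> [x i|].
  by rewrite pf pk.
by apply/smooth_uptoP => n; exact: smooth_uptoM.
Qed.

Lemma smooth_torus_sum (I : Type) (r : seq I) (F : I -> 'rV[R]_d -> R) :
  (forall i, smooth_torus (F i)) -> smooth_torus (fun x => \sum_(i <- r) F i x).
Proof.
move=> sF; elim: r => [|i r IH].
  under eq_fun do rewrite big_nil.
  by split=> //; apply/smooth_uptoP => n; exact: smooth_upto_cst0.
by under eq_fun do rewrite big_cons; exact: smooth_torusD.
Qed.

(** The difference quotients at both points are the same function, so the derivatives agree even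
    where no limit exists. *)
Lemma derive_periodic f v : torus_periodic f -> torus_periodic ('D_v f).
Proof.
move=> pf x i; rewrite /derive.
rewrite (_ : (fun t => t^-1 *: ((f \o shift (x + unit_vec R i)) (t *: v) - _)) =
  (fun t => t^-1 *: ((f \o shift x) (t *: v) - f x)))//.
by apply/funext => t /=; rewrite pf addrA pf.
Qed.

Lemma smooth_torus_partials s f : smooth_torus f -> smooth_torus (partials s f).
Proof.
move=> [pf sf]; split.
  by rewrite /partials; elim: s => //= i s IH; exact: derive_periodic.
move=> s' x xT; rewrite /partials /iter_derive -foldr_cat.
exact: sf.
Qed.

Lemma smooth_torus_continuous f : smooth_torus f -> continuous f.
Proof. by move=> [_ sf] x; have [] := sf [::] x I. Qed.

Lemma partials_cat s1 s2 f :
  partials (s1 ++ s2) f = partials s1 (partials s2 f).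
Proof. by rewrite /partials map_cat /iter_derive foldr_cat. Qed.

Definition torus_laplacian f x := \sum_i partials [:: i; i] f x.

Lemma smooth_torus_laplacian f :
  smooth_torus f -> smooth_torus (torus_laplacian f).
Proof.
by move=> sf; apply: smooth_torus_sum => i; exact: smooth_torus_partials.
Qed.

End smooth_torus_algebra.

(** * Weak derivatives and integration by parts *)

Section weak_derivatives.
Context (R : realType) (d : nat).
Local Notation mu := (cube_measure R d).
Implicit Types (f k phi w : 'rV[R]_d -> R) (s : seq 'I_d).

Definition torus_integrable f := ae_integrable mu (f \o @vec_of_tuple R d).

Lemma eq_int_torus f k : f =1 k -> int_torus f = int_torus k.
Proof. by move=> /funext->. Qed.

Lemma Lp1P f : Lp 1 f <-> torus_periodic f /\ torus_integrable f.
Proof.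
split=> -[pf [b bL fb]]; split=> //; exists b => //; exact/Lfun1_integrable.
Qed.

Lemma Lp_subset1 (p : R) f : 1 <= p -> Lp p f -> Lp 1 f.
Proof.
move=> p1 [pf [b bL fb]]; split=> //; exists b => //.
by apply: Lfun_subset bL => //; exact: fin_num_measure.
Qed.

Lemma Lp_torus_integrable (p : R) f : 1 <= p -> Lp p f -> torus_integrable f.
Proof. by move=> p1 /(Lp_subset1 p1) /Lp1P[]. Qed.

Lemma torus_integrableM f phi : torus_integrable f -> smooth_torus phi ->
  torus_integrable (fun x => f x * phi x).
Proof.
move=> intf sphi; have cphi := smooth_torus_continuous sphi.
have [C phiC] := continuous_periodic_bounded sphi.1 cphi.
apply: (@ae_integrableM _ _ _ mu _ (phi \o @vec_of_tuple R d) C) => //.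
  exact: measurable_vec_of_tuple.
by move=> t; exact: phiC.
Qed.

(** For the empty multi-index [weak_deriv] returns [f] itself instead of a chosen version, so this
    case is checked directly. *)
Lemma weak_derivP s f :
  has_weak_deriv s f -> is_weak_deriv s f (weak_deriv s f).
Proof.
rewrite /weak_deriv; case: nilP => [->|_] [w ws]; last exact: xgetI ws.
have [Lf _ _] := ws; split=> // phi sphi.
by rewrite mul1r.
Qed.

(** The derivatives are only required in L^1, which is enough for pairing them with smooth functions
    and is stable under [wlaplacian]. *)
Definition weakly_differentiable n f :=
  forall s, (size s <= n)%N -> has_weak_deriv s f.

Lemma weakly_differentiable_leq n m f :
  (n <= m)%N -> weakly_differentiable m f -> weakly_differentiable n f.
Proof. by move=> nm wf s sn; apply: wf; exact: leq_trans sn nm. Qed.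

Lemma weakly_differentiable_Lp1 n f : weakly_differentiable n f -> Lp 1 f.
Proof. by move=> wf; have [w [Lf _ _]] := wf [::] (leq0n _). Qed.

Lemma W_space_weakly_differentiable n p f :
  fmem (W_space d n p) f -> weakly_differentiable n f.
Proof. by move=> Wf s sn; exists (weak_deriv s f); exact: (Wf s sn).2. Qed.

Lemma int_weak_deriv s f phi : has_weak_deriv s f -> smooth_torus phi ->
  int_torus (fun x => weak_deriv s f x * phi x) =
  (-1) ^+ size s * int_torus (fun x => f x * partials s phi x).
Proof.
by move=> /weak_derivP[_ _ sf] sphi; rewrite sf// mulrA -expr2 sqrr_sign mul1r.
Qed.

Lemma Lp1_sum (I : Type) (r : seq I) (F : I -> 'rV[R]_d -> R) :
  (forall i, Lp 1 (F i)) -> Lp 1 (fun x => \sum_(i <- r) F i x).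
Proof.
move=> LF; apply/Lp1P; split=> [x j|].
  by apply: eq_bigr => i _; have /Lp1P[-> ] := LF i.
by apply: ae_integrable_sum => i; have /Lp1P[] := LF i.
Qed.

Lemma int_torus_sum (I : Type) (r : seq I) (F : I -> 'rV[R]_d -> R) :
  (forall i, torus_integrable (F i)) ->
  int_torus (fun x => \sum_(i <- r) F i x) = \sum_(i <- r) int_torus (F i).
Proof. by move=> iF; exact: (Rintegral_sum_ae r iF). Qed.

(** The derivative [s] of the weak Laplacian is the sum of the derivatives [[:: i; i] ++ s] of [f];
    with this order of concatenation no mixed partials are exchanged. *)
Lemma weakly_differentiable_wlaplacian n f :
  weakly_differentiable n.+2 f -> weakly_differentiable n (wlaplacian f).
Proof.
move=> wf s sn.
have w2 i : has_weak_deriv [:: i; i] f by apply: wf; rewrite /= ltnS ltnS.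
have ws i : has_weak_deriv ([:: i; i] ++ s) f by apply: wf; rewrite /= !ltnS.
exists (fun x => \sum_i weak_deriv ([:: i; i] ++ s) f x); split.
- by apply: Lp1_sum => i; have [] := weak_derivP (w2 i).
- by apply: Lp1_sum => i; have [] := weak_derivP (ws i).
move=> phi sphi.
under [in LHS]eq_int_torus do rewrite /wlaplacian mulr_suml.
under [in RHS]eq_int_torus do rewrite mulr_suml.
have sD := smooth_torus_partials s sphi.
rewrite (@int_torus_sum _ _
  (fun i x => weak_deriv [:: i; i] f x * partials s phi x)).
rewrite (@int_torus_sum _ _
  (fun i x => weak_deriv ([:: i; i] ++ s) f x * phi x)).
  rewrite mulr_sumr; apply: eq_bigr => i _.
  (* The sign on the right has exponent [size s + (2 + size s)], which is even, as is the exponent 2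
     on the left. *)
  rewrite !int_weak_deriv// size_cat partials_cat mulrA -exprD; congr (_ * _).
  by rewrite addnCA exprD addnn -mul2n exprM (sqrrN 1) expr1n expr1n mulr1.
- move=> i; apply: torus_integrableM => //.
  by have [_ /Lp1P[]] := weak_derivP (ws i).
- move=> i; apply: torus_integrableM => //.
  by have [_ /Lp1P[]] := weak_derivP (w2 i).
Qed.

Lemma int_wlaplacian f phi : weakly_differentiable 2 f -> smooth_torus phi ->
  int_torus (fun x => wlaplacian f x * phi x) =
  int_torus (fun x => f x * torus_laplacian phi x).
Proof.
move=> wf sphi; have w2 i : has_weak_deriv [:: i; i] f by exact: wf.
have /Lp1P[_ intf] := weakly_differentiable_Lp1 wf.
under [in LHS]eq_int_torus do rewrite /wlaplacian mulr_suml.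
under [in RHS]eq_int_torus do rewrite /torus_laplacian mulr_sumr.
rewrite (@int_torus_sum _ _ (fun i x => weak_deriv [:: i; i] f x * phi x)).
rewrite (@int_torus_sum _ _ (fun i x => f x * partials [:: i; i] phi x)).
- by apply: eq_bigr => i _; rewrite int_weak_deriv// /= sqrrN expr1n mul1r.
- by move=> i; exact: (torus_integrableM intf (smooth_torus_partials _ sphi)).
- move=> i; apply: torus_integrableM => //.
  by have [_ /Lp1P[]] := weak_derivP (w2 i).
Qed.

Lemma smooth_torus_iter_laplacian n phi :
  smooth_torus phi -> smooth_torus (iter n (@torus_laplacian R d) phi).
Proof.
move=> sphi; elim: n => [|n IH]; first exact: sphi.
by rewrite iterS; exact: (smooth_torus_laplacian IH).
Qed.

(** Each Laplacian costs two orders; the induction is used at [m.+2]. *)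
Lemma weakly_differentiable_iter_wlaplacian n m f :
  weakly_differentiable (2 * n + m) f ->
  weakly_differentiable m (iter n (@wlaplacian R d) f).
Proof.
elim: n m => [|n IH] m wf; first exact: wf.
by rewrite iterS; apply/weakly_differentiable_wlaplacian/IH;
  rewrite !addnS; move: wf; rewrite mulnS.
Qed.

(** The outermost weak Laplacian moves onto [phi], and the induction hypothesis is applied to the
    test function [torus_laplacian phi]. *)
Lemma int_iter_wlaplacian n f phi :
  weakly_differentiable (2 * n) f -> smooth_torus phi ->
  int_torus (fun x => iter n (@wlaplacian R d) f x * phi x) =
  int_torus (fun x => f x * iter n (@torus_laplacian R d) phi x).
Proof.
elim: n phi => [|n IH] phi wf sphi; first by [].
rewrite [iter n.+1 _ phi]iterSr -IH.
- rewrite iterS; apply: int_wlaplacian sphi.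
  by apply: weakly_differentiable_iter_wlaplacian; rewrite addnC -mulnS.
- by apply: weakly_differentiable_leq wf; rewrite leq_mul2l/= leqnSn.
- exact: smooth_torus_laplacian.
Qed.

End weak_derivatives.

(** * Weak convergence tested against smooth functions *)

Section bounded_functionals.
Context (R : realType) (d : nat).
Local Notation mu := (cube_measure R d).
Implicit Types (f phi : 'rV[R]_d -> R).

Lemma Lp_norm_ge0 (p : R) f : 0 <= Lp_norm p f.
Proof. by apply: fine_ge0; exact: Lnorm_ge0. Qed.

Lemma ae_eq_Lnorm (p : R) (f b : d.-tuple (measurableTypeR R) -> R) :
  (\forall t \ae mu, f t = b t) ->
  (Lnorm mu p%:E (EFin \o f) = Lnorm mu p%:E (EFin \o b))%E.
Proof.
move=> fb; rewrite unlock /=; congr (_ `^ _)%E; apply: ae_eq_integralT.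
by apply: filterS fb => t /= ->.
Qed.

(** Hölder's inequality against the constant 1, whose norm is 1 on a probability space; [1 < p]
    makes the conjugate exponent [(1 - p^-1)^-1] finite. *)
Lemma Lp_norm_le (p : R) f : 1 < p -> Lp p f -> Lp_norm 1 f <= Lp_norm p f.
Proof.
move=> p1 [pf [b bL fb]]; have p0 : 0 < p by exact: lt_trans p1.
have Lb r : Lp_norm r f = fine (Lnorm mu r%:E (EFin \o b)).
  by congr fine; exact: (ae_eq_Lnorm r fb).
have /andP[] := bL; rewrite inE => mb; rewrite inE /= /finite_norm => nb.
have b1L := Lfun_subset (lexx 1%E) _ _ _ bL.
have /andP[_] : b \in Lfun mu 1%E.
  by apply: b1L; rewrite ?lee_fin ?ltW//; exact: fin_num_measure.
rewrite inE /= /finite_norm => nb1.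
(* Both extended norms have to be finite before their [fine] values compare. *)
rewrite !Lb; apply: fine_le.
- by rewrite ge0_fin_numE// Lnorm_ge0.
- by rewrite ge0_fin_numE// Lnorm_ge0.
have := @hoelder _ _ _ mu b (cst 1) p (1 - p^-1)^-1 mb (measurable_cst _) p0.
rewrite Lnorm_cst1 [X in poweR X _](_ : _ = 1%E); last exact: probability_setT.
rewrite poweR1r mule1 invrK subrKC.
rewrite (_ : b \* cst 1 = b); last by apply/funext => t /=; rewrite mulr1.
by apply=> //; rewrite invr_gt0 subr_gt0 invf_lt1.
Qed.

Lemma W_space_norm_ge (k : nat) (p : R) f :
  Lp_norm p f <= fnorm (W_space d k p) f.
Proof.
(* The term of order 0 has the empty tuple as its only index and equals the norm of [f]; the others
   are nonnegative. *)
rewrite /= big_ord_recl /=.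
rewrite (big_pred1 [tuple]) => [|s]; last by rewrite [s]tuple0 /= eqxx.
rewrite -[leLHS]addr0 lerD2l//; apply: sumr_ge0 => j _; apply: sumr_ge0 => s _.
exact: Lp_norm_ge0.
Qed.

Lemma int_torus_mul_lin a f g phi : torus_integrable f -> torus_integrable g ->
  smooth_torus phi ->
  int_torus (fun x => (a * f x + g x) * phi x) =
  a * int_torus (fun x => f x * phi x) + int_torus (fun x => g x * phi x).
Proof.
move=> intf intg sphi.
under eq_int_torus do rewrite mulrDl -mulrA.
have intfphi := torus_integrableM intf sphi.
exact: (Rintegral_lin a intfphi (torus_integrableM intg sphi)).
Qed.

Lemma int_torus_mul_bound phi : smooth_torus phi -> exists2 C, 0 <= C &
  forall f, torus_integrable f ->
    `|int_torus (fun x => f x * phi x)| <= C * Lp_norm 1 f.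
Proof.
move=> sphi; have cphi := smooth_torus_continuous sphi.
have [C phiC] := continuous_periodic_bounded sphi.1 cphi.
exists C => [|f intf]; first exact: le_trans (normr_ge0 _) (phiC 0).
rewrite /Lp_norm Lnorm1.
apply: (@norm_RintegralM _ _ _ mu _ (phi \o @vec_of_tuple R d)) => //.
  exact: measurable_vec_of_tuple.
by move=> t; exact: phiC.
Qed.

Lemma weak_cvg_int_Lp1 (fn : nat -> 'rV[R]_d -> R) f phi :
  weak_cvg (Lp_space d 1) fn f -> smooth_torus phi ->
  int_torus (fun x => fn n x * phi x) @[n --> \oo] -->
  int_torus (fun x => f x * phi x).
Proof.
move=> [_ _ fnf] sphi; apply: (fnf (fun f => int_torus (fun x => f x * phi x))).
split=> [a u v /Lp1P[_ iu] /Lp1P[_ iv]|]; first exact: int_torus_mul_lin.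
have [C _ phiC] := int_torus_mul_bound sphi.
by exists C => u /Lp1P[_ iu]; exact: phiC.
Qed.

(** Pairing with [phi] is bounded by the L^1 norm, hence by the L^p norm, hence by the Sobolev norm,
    so it is an admissible functional. *)
Lemma weak_cvg_int_W (k : nat) (p : R) (fn : nat -> 'rV[R]_d -> R) f phi :
  1 < p -> weak_cvg (W_space d k p) fn f -> smooth_torus phi ->
  int_torus (fun x => fn n x * phi x) @[n --> \oo] -->
  int_torus (fun x => f x * phi x).
Proof.
move=> p1 [_ _ fnf] sphi.
apply: (fnf (fun f => int_torus (fun x => f x * phi x))).
have WL u : fmem (W_space d k p) u -> Lp p u by case/(_ [::] (leq0n _)).
have Wi u : fmem (W_space d k p) u -> torus_integrable u.
  by move=> /WL; apply: Lp_torus_integrable; exact: ltW.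
split=> [a u v /Wi iu /Wi iv|]; first exact: int_torus_mul_lin.
have [C C0 phiC] := int_torus_mul_bound sphi.
exists C => u Wu; apply: le_trans (phiC _ (Wi _ Wu)) _; apply: ler_wpM2l => //.
exact: le_trans (Lp_norm_le p1 (WL _ Wu)) (W_space_norm_ge k p u).
Qed.

End bounded_functionals.

(** The infimum of the tail from [n] is at most its first term [u n], hence at most [v n]. *)
Lemma limn_einf_le_cvg (R : realType) (u v : (\bar R)^nat) (l : \bar R) :
  (forall n, u n <= v n)%E -> v @ \oo --> l -> (limn_einf u <= l)%E.
Proof.
move=> uv vl; rewrite limn_einf_lim -(cvg_lim _ vl)//; apply: lee_lim.
- exact: is_cvg_einfs.
- by apply/cvg_ex; exists l.
apply: nearW => n; apply: le_trans (uv n).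
by apply: ereal_inf_lbound; exists n => /=.
Qed.

(** * Adding an integrable function to one whose integral may be infinite *)

Section semi_integrable.
Context d (T : measurableType d) (R : realType).
Context (mu : {measure set T -> \bar R}).
Implicit Types (f b c : T -> R).
Local Open Scope ereal_scope.

Let measurable_funepos_EFin b : measurable_fun setT b ->
  measurable_fun setT (EFin \o b)^\+.
Proof. by move=> mb; apply: measurable_funepos; exact/measurable_EFinP. Qed.

Let measurable_funeneg_EFin b : measurable_fun setT b ->
  measurable_fun setT (EFin \o b)^\-.
Proof. by move=> mb; apply: measurable_funeneg; exact/measurable_EFinP. Qed.

Lemma integrable_posneg b : measurable_fun setT b ->
  \int[mu]_t ((EFin \o b)^\+ t) < +oo -> \int[mu]_t ((EFin \o b)^\- t) < +oo ->
  mu.-integrable setT (EFin \o b).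
Proof.
move=> mb bp bn; apply/integrableP; split; first exact/measurable_EFinP.
rewrite (_ : (fun t => _) = (fun t => (EFin \o b)^\+ t + (EFin \o b)^\- t)).
  rewrite ge0_integralD//.
  - exact: lte_add_pinfty.
  - exact: measurable_funepos_EFin.
  - exact: measurable_funeneg_EFin.
apply/funext => t.
by rewrite -[RHS]/(((EFin \o b)^\+ \+ (EFin \o b)^\-) t) -fune_abse.
Qed.

(* The integral of [f] may be [-oo]. *)
Lemma semi_integrableD_le f b c (r : R) :
  measurable_fun setT b -> (\forall t \ae mu, f t = b t) ->
  \int[mu]_t ((EFin \o b)^\+ t) < +oo \/ \int[mu]_t ((EFin \o b)^\- t) < +oo ->
  ae_integrable mu c -> \int[mu]_t (f t)%:E <= r%:E ->
  (exists2 b' : T -> R, measurable_fun setT b' /\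
     (\forall t \ae mu, (f t + c t)%R = b' t) &
     \int[mu]_t ((EFin \o b')^\+ t) < +oo \/
     \int[mu]_t ((EFin \o b')^\- t) < +oo) /\
  \int[mu]_t (f t + c t)%:E <= (r + \int[mu]_t c t)%:E.
Proof.
move=> mb fb bpn ic fr; have [k ik ck] := ic.
have mk : measurable_fun setT k by exact/measurable_EFinP/(measurable_int mu).
have mbk : measurable_fun setT (fun t => b t + k t)%R by exact: measurable_funD.
have fcbk : \forall t \ae mu, (f t + c t = b t + k t)%R.
  by apply: filterS2 fb ck => t -> ->.
have ikoo : \int[mu]_t `|(k t)%:E| < +oo by have /integrableP[] := ik.
have fE : \int[mu]_t (f t)%:E = \int[mu]_t ((EFin \o b) t).
  by apply: ae_eq_integralT; apply: filterS fb => t ->.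
(* An infinite positive part would come with a finite negative part and make the integral [+oo],
   against the bound [r]. *)
have bp : \int[mu]_t ((EFin \o b)^\+ t) < +oo.
  case: bpn => // bn; rewrite ltey; apply/eqP => bpy.
  move: fr; rewrite fE integralE bpy addye ?leye_eq//.
  by apply/eqP => /(congr1 oppe); rewrite oppeK => bny; rewrite bny in bn.
have bkp : \int[mu]_t ((EFin \o (fun t => b t + k t)%R)^\+ t) < +oo.
  apply: (@le_lt_trans _ _
    (\int[mu]_t ((EFin \o b)^\+ t + `|(k t)%:E|))).
    apply: ge0_le_integral => //.
    - exact: measurable_funepos_EFin.
    - apply: emeasurable_funD; first exact: measurable_funepos_EFin.
      by apply: measurableT_comp => //; exact/measurable_EFinP.
    move=> t _; rewrite !funeposE /= ge_max; apply/andP; split.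
      by rewrite EFinD leeD// ?le_max ?lexx// lee_fin ler_norm.
    by rewrite adde_ge0// le_max lexx orbT.
  rewrite ge0_integralD//; first exact: lte_add_pinfty.
  - exact: measurable_funepos_EFin.
  - by apply: measurableT_comp => //; exact/measurable_EFinP.
split; first by exists (fun t => b t + k t)%R => //; left.
(* Either [f] is integrable and the integral is additive, or the negative part is infinite and
   remains so after adding [k]; the sum then integrates to [-oo]. *)
have [bn|bn] := boolP (\int[mu]_t ((EFin \o b)^\- t) < +oo).
  have if_ : ae_integrable mu f by exists b => //; exact: integrable_posneg.
  rewrite (ae_integrable_EFin (ae_integrableD if_ ic)) lee_fin RintegralD_ae//.
  by rewrite lerD2r -lee_fin -ae_integrable_EFin.
rewrite (_ : \int[mu]_t _ = \int[mu]_t ((EFin \o (fun t => b t + k t)%R) t)).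
  2: by apply: ae_eq_integralT; apply: filterS fcbk => t ->.
rewrite integralE.
suff -> : \int[mu]_t ((EFin \o (fun t => b t + k t)%R)^\- t) = +oo.
  by rewrite addeNy leNye.
(* Since [b = (b + k) - k], the negative part of [b] is at most that of [b + k] plus [|k|]. *)
apply/eqP; rewrite -leye_eq leNgt; apply: contra bn => bkn.
apply: (@le_lt_trans _ _ (\int[mu]_t
  ((EFin \o (fun t => b t + k t)%R)^\- t + `|(k t)%:E|))).
  apply: ge0_le_integral => //.
  - exact: measurable_funeneg_EFin.
  - apply: emeasurable_funD; first exact: measurable_funeneg_EFin.
    by apply: measurableT_comp => //; exact/measurable_EFinP.
  move=> t _; rewrite !funenegE /= ge_max; apply/andP; split; last first.
    by rewrite adde_ge0// le_max lexx orbT.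
  rewrite (_ : (- b t)%:E = (- (b t + k t))%:E + (k t)%:E).
    by apply: leeD; [rewrite le_max lexx|rewrite lee_fin ler_norm].
  by rewrite -EFinD opprD subrK.
rewrite ge0_integralD//; first exact: lte_add_pinfty.
- exact: measurable_funeneg_EFin.
- by apply: measurableT_comp => //; exact/measurable_EFinP.
Qed.

End semi_integrable.

(** * The integrated inequality for the regularized system *)

Section regularized_inequality.
Context (R : realType) (d : nat) (E : set R).
Context (Epos : forall s, 0 < s -> E s).
Context (H : 'rV[R]_d -> 'rV[R]_d -> 'M[R]_d -> R -> R -> R).
Context (h : ('rV[R]_d -> R) -> ('rV[R]_d -> R)).
Context (H0 : 'rV[R]_d -> 'rV[R]_d -> R -> R -> R) (a : 'rV[R]_d -> 'M[R]_d).
Context (H_split : forall x p M mu theta, E mu ->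
  H x p M mu theta = H0 x p mu theta - mx_contract (a x) M).
Context (a_smooth : forall i j, smooth_torus (fun x => a x i j)).
Implicit Types (m u phi : 'rV[R]_d -> R).

(** The formal adjoint of [v |-> a : D^2 v]. *)
Definition adjoint_diffusion phi (x : 'rV[R]_d) : R :=
  \sum_i \sum_j partials [:: i; j] (fun y => phi y * a y i j) x.

Lemma smooth_torus_adjoint_diffusion phi :
  smooth_torus phi -> smooth_torus (adjoint_diffusion phi).
Proof.
move=> sphi; apply: smooth_torus_sum => i; apply: smooth_torus_sum => j.
by apply: smooth_torus_partials; exact: (smooth_torusM sphi (a_smooth i j)).
Qed.

(** Each [phi * a_ij] is a smooth test function for the weak derivative of index [[:: i; j]], and
    two integrations by parts leave the sign unchanged. *)
Lemma int_adjoint_diffusion u phi :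
  weakly_differentiable 2 u -> smooth_torus phi ->
  torus_integrable (fun x => phi x * mx_contract (a x) (whess u x)) /\
  int_torus (fun x => phi x * mx_contract (a x) (whess u x)) =
  int_torus (fun x => u x * adjoint_diffusion phi x).
Proof.
move=> wu sphi.
have w2 i j : has_weak_deriv [:: i; j] u by exact: wu.
have sa i j : smooth_torus (fun x => phi x * a x i j).
  exact: (smooth_torusM sphi (a_smooth i j)).
have iw i j : torus_integrable
    (fun x => weak_deriv [:: i; j] u x * (phi x * a x i j)).
  have [_ /Lp1P[_ iu] _] := weak_derivP (w2 i j).
  exact: (torus_integrableM iu (sa i j)).
have iu : torus_integrable u by have /Lp1P[] := weakly_differentiable_Lp1 wu.
have ip i j : torus_integrable
    (fun x => u x * partials [:: i; j] (fun y => phi y * a y i j) x).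
  exact: (torus_integrableM iu (smooth_torus_partials _ (sa i j))).
have -> : (fun x => phi x * mx_contract (a x) (whess u x)) =
    (fun x => \sum_i \sum_j weak_deriv [:: i; j] u x * (phi x * a x i j)).
  apply/funext => x; rewrite /mx_contract mulr_sumr; apply: eq_bigr => i _.
  rewrite mulr_sumr; apply: eq_bigr => j _.
  by rewrite mxE mulrA mulrC.
have iws i : torus_integrable
    (fun x => \sum_j weak_deriv [:: i; j] u x * (phi x * a x i j)).
  exact: (ae_integrable_sum _ (iw i)).
split; first exact: (ae_integrable_sum _ iws).
rewrite (int_torus_sum _ iws).
have -> : (fun x => u x * adjoint_diffusion phi x) =
    (fun x => \sum_i \sum_j
       u x * partials [:: i; j] (fun y => phi y * a y i j) x).
  by apply/funext => x; rewrite mulr_sumr; under eq_bigr do rewrite mulr_sumr.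
have ips i : torus_integrable (fun x => \sum_j u x *
    partials [:: i; j] (fun y => phi y * a y i j) x).
  exact: (ae_integrable_sum _ (ip i)).
rewrite (int_torus_sum _ ips); apply: eq_bigr => i _.
rewrite (int_torus_sum _ (iw i)) (int_torus_sum _ (ip i)).
apply: eq_bigr => j _.
by rewrite (int_weak_deriv (w2 i j) (sa i j)) /= sqrrN expr1n mul1r.
Qed.

(** The positive lower bound puts the values in [E] whether or not [E] contains 0; lower
    semicontinuity is available along such densities. *)
Lemma regularized_solution_MacE N beta e1 e2 m u :
  regularized_solution H h N beta e1 e2 m u -> MacE E m.
Proof.
move=> [[Wm _ [c c0 cm]] _ _ _ _].
split; [split|].
- exact: weakly_differentiable_Lp1 (W_space_weakly_differentiable Wm).
- by apply: filterS cm => t; apply: le_trans; exact: ltW.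
- by apply: filterS cm => t cmt; apply: Epos; exact: lt_le_trans cmt.
Qed.

(** On the right [m] and [u] appear only in integrals against smooth functions built from [phi], the
    form on which weak convergence acts. *)
Lemma regularized_solution_le (N : nat) beta (e1 e2 : R) m u phi :
  (0 < N)%N -> (forall s, 0 < s -> beta e1 s <= 0) ->
  regularized_solution H h N beta e1 e2 m u ->
  smooth_torus phi -> (forall x, 0 <= phi x) ->
  (eint_torus (fun x => (phi x * comp_H0 h H0 m u x)%:E) <=
   (int_torus (fun x => u x * adjoint_diffusion phi x)
    - int_torus (fun x => u x * phi x)
    + e1 * (int_torus (fun x => m x * phi x) + int_torus
        (fun x => m x * iter (2 * N) (@torus_laplacian R d) phi x))
    + e2 * (int_torus (fun x => m x * phi x)
        - int_torus (fun x => m x * torus_laplacian phi x)))%:E)%E.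
Proof.
move=> N0 beta0 [[Wm Wu [c c0 cm]] eqH _ _ _] sphi phi0.
have wm := W_space_weakly_differentiable Wm.
have wu := W_space_weakly_differentiable Wu.
have N4 : (2 <= 4 * N)%N by rewrite (@leq_trans (4 * 1))// leq_mul2l.
have wm2 := weakly_differentiable_leq N4 wm.
have wu2 := weakly_differentiable_leq N4 wu.
(* The power [2 * N] of the Laplacian takes exactly the [4 * N] derivatives of the domain. *)
have wmN : weakly_differentiable (2 * (2 * N)) m by rewrite mulnA.
have /Lp1P[_ im] := weakly_differentiable_Lp1 wm.
have /Lp1P[_ iu] := weakly_differentiable_Lp1 wu.
have imp := torus_integrableM im sphi.
have iup := torus_integrableM iu sphi.
have /Lp1P[_ iL] : Lp 1 (iter (2 * N) (@wlaplacian R d) m).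
  apply: (@weakly_differentiable_Lp1 _ _ 0).
  by apply: weakly_differentiable_iter_wlaplacian; rewrite addn0.
have iLp := torus_integrableM iL sphi.
have /Lp1P[_ il] : Lp 1 (wlaplacian m).
  apply: (@weakly_differentiable_Lp1 _ _ 0).
  exact: weakly_differentiable_wlaplacian.
have ilp := torus_integrableM il sphi.
have [iap iapE] := int_adjoint_diffusion wu2 sphi.
(* [K1], [K2] and [K3] collect the terms with factor 1, [e1] and [e2]. *)
pose K1 x := phi x * mx_contract (a x) (whess u x) - u x * phi x.
pose K2 x := m x * phi x + iter (2 * N) (@wlaplacian R d) m x * phi x.
pose K3 x := m x * phi x - wlaplacian m x * phi x.
have iK1 : torus_integrable K1 := ae_integrableB iap iup.
have iK2 : torus_integrable K2 := ae_integrableD imp iLp.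
have iK3 : torus_integrable K3 := ae_integrableB imp ilp.
pose K x := K1 x + e1 * K2 x + e2 * K3 x.
have iK12 : torus_integrable (fun x => K1 x + e1 * K2 x) :=
  ae_integrableD iK1 (ae_integrableZ e1 iK2).
have iK : torus_integrable K := ae_integrableD iK12 (ae_integrableZ e2 iK3).
have intK : int_torus K = int_torus K1 + e1 * int_torus K2 + e2 * int_torus K3.
  rewrite [LHS](RintegralD_ae iK12 (ae_integrableZ e2 iK3)).
  rewrite (RintegralD_ae iK1 (ae_integrableZ e1 iK2)).
  by rewrite (RintegralZ_ae e1 iK2) (RintegralZ_ae e2 iK3).
have intK1 : int_torus K1 = int_torus (fun x => u x * adjoint_diffusion phi x)
    - int_torus (fun x => u x * phi x).
  by rewrite [LHS](RintegralB_ae iap iup) -iapE.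
have intK2 : int_torus K2 = int_torus (fun x => m x * phi x) +
    int_torus (fun x => m x * iter (2 * N) (@torus_laplacian R d) phi x).
  by rewrite [LHS](RintegralD_ae imp iLp) -(int_iter_wlaplacian wmN sphi).
have intK3 : int_torus K3 = int_torus (fun x => m x * phi x) -
    int_torus (fun x => m x * torus_laplacian phi x).
  by rewrite [LHS](RintegralB_ae imp ilp) -(int_wlaplacian wm2 sphi).
(* As [K] is integrable, its real integral is its extended one, and an almost everywhere comparison
   of integrands suffices. *)
rewrite -intK1 -intK2 -intK3 -intK -[X in (_ <= X)%E](ae_integrable_EFin iK).
rewrite /ae_torus in eqH cm.
apply: ae_le_integralT; apply: filterS2 eqH cm => t; set x := vec_of_tuple t.
move=> eqx cmx; have mx0 : 0 < m x by exact: (lt_le_trans c0 cmx).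
rewrite lee_fin.
have KE : K x = phi x * (mx_contract (a x) (whess u x) - u x +
    e1 * (m x + iter (2 * N) (@wlaplacian R d) m x) +
    e2 * (m x - wlaplacian m x)).
  by rewrite /K /K1 /K2 /K3 -!mulrBl -mulrDl ![_ * phi x]mulrC
    -mulrBr ![e1 * _]mulrCA ![e2 * _]mulrCA -!mulrDr.
(* Up to the factor [phi x], the two sides differ by [beta e1 (m x)], which is nonpositive. *)
rewrite [leRHS]KE; apply: ler_wpM2l => //; have := beta0 _ mx0.
move: eqx; rewrite (H_split _ _ _ _ (Epos mx0)) /comp_H0.
lra.
Qed.

End regularized_inequality.

(** * Passage to the limit in the integrated inequality *)

Theorem proposition5p1 (R : realType) (d : nat) (hd : (1 <= d)%N)
  (E : set R) (hE : E = [set s | 0 < s] \/ E = [set s | 0 <= s])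
  (H : 'rV[R]_d -> 'rV[R]_d -> 'M[R]_d -> R -> R -> R)
  (H_periodic : forall p M mu theta, torus_periodic (fun x => H x p M mu theta))
  (h : ('rV[R]_d -> R) -> ('rV[R]_d -> R)) (h_valid : operator_valid h)
  (g g1 g2 : 'rV[R]_d -> R -> R -> R)
  (gamma : R)
  (H0 : 'rV[R]_d -> 'rV[R]_d -> R -> R -> R) (a : 'rV[R]_d -> 'M[R]_d)
  (h_reg : h_regularity h)
  (g_cont : g_continuous E g)
  (g_str : g_structure E h g g1 g2)
  (g_comp : g_compactness E h g1)
  (H_gr : H_growth E H h g gamma)
  (H_smooth : H_smoothness E H)
  (H_mono : monotonicity E H h)
  (H_deg : degenerate_lsc E H h H0 a gamma)
  (N : nat) (hN : d%:R / 2 + 1 < 2 * N%:R - 4 :> R)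
  (q : R) (hq : d%:R < q)
  (beta : R -> R -> R) (hbeta : penalization q beta)
  (meps ueps : R -> R -> 'rV[R]_d -> R)
  (heps : forall e1 e2, 0 < e1 < 1 -> 0 < e2 < 1 ->
     regularized_solution H h N beta e1 e2 (meps e1 e2) (ueps e1 e2))
  (m u : 'rV[R]_d -> R)
  (hm : Mac m) (hu : fmem (W_space d 1 gamma) u)
  (hm1 : int_torus m = 1)
  (hweak : weak_solution E H h (regular_distribution m) (regular_distribution u))
  (e1 e2 : nat -> R)
  (he1 : forall n, 0 < e1 n < 1) (he2 : forall n, 0 < e2 n < 1)
  (he1_0 : e1 n @[n --> \oo] --> 0) (he2_0 : e2 n @[n --> \oo] --> 0)
  (hm_lim : weak_cvg (Lp_space d 1) (fun n => meps (e1 n) (e2 n)) m)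
  (hu_lim : weak_cvg (W_space d 1 gamma) (fun n => ueps (e1 n) (e2 n)) u)
  (phi : 'rV[R]_d -> R) (hphi : smooth_torus phi) (phi_ge0 : forall x, 0 <= phi x) :
  let integrand x :=
    phi x * (u x + comp_H0 h H0 m u x)
    - (\sum_i \sum_j partials [:: i; j] (fun y => phi y * a y i j) x) * u x in
  has_integral integrand /\ (eint_torus (fun x => (integrand x)%:E) <= 0)%E.
Proof.
have [gamma1 _] := H_gr.
have [H_split _ a_smooth /(_ phi hphi phi_ge0)[semi_int lsc]] := H_deg.
have Epos s : 0 < s -> E s by case: hE => -> //=; exact: ltW.
have N0 : (0 < N)%N.
  (* For [N = 0] the bound [hN] would put a positive number below [-4]. *)
  rewrite lt0n; apply/eqP => N0; move: hN; rewrite N0 mulr0 sub0r.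
  by have := ler0n R d; lra.
pose mn n := meps (e1 n) (e2 n); pose un n := ueps (e1 n) (e2 n).
have sol n := heps _ _ (he1 n) (he2 n).
have mnE n : MacE E (mn n) := regularized_solution_MacE Epos (sol n).
pose S := adjoint_diffusion a phi.
have sS : smooth_torus S := smooth_torus_adjoint_diffusion a_smooth hphi.
have iu : torus_integrable u.
  by apply: Lp_torus_integrable (ltW gamma1) _; exact: (hu [::] isT).1.
have iup := torus_integrableM iu hphi; have iuS := torus_integrableM iu sS.
pose L1 := iter (2 * N) (@torus_laplacian R d) phi.
pose L2 := torus_laplacian phi.
have sL1 : smooth_torus L1 := smooth_torus_iter_laplacian _ hphi.
have sL2 : smooth_torus L2 := smooth_torus_laplacian hphi.
pose r := int_torus (fun x => u x * S x) - int_torus (fun x => u x * phi x).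
pose rn n := int_torus (fun x => un n x * S x)
    - int_torus (fun x => un n x * phi x)
    + e1 n * (int_torus (fun x => mn n x * phi x)
        + int_torus (fun x => mn n x * L1 x))
    + e2 n * (int_torus (fun x => mn n x * phi x)
        - int_torus (fun x => mn n x * L2 x)).
have rn_cvg : rn n @[n --> \oo] --> r.
  have mnc psi : smooth_torus psi -> int_torus (fun x => mn n x * psi x)
      @[n --> \oo] --> int_torus (fun x => m x * psi x).
    exact: weak_cvg_int_Lp1 hm_lim.
  have unc psi : smooth_torus psi -> int_torus (fun x => un n x * psi x)
      @[n --> \oo] --> int_torus (fun x => u x * psi x).
    exact: weak_cvg_int_W gamma1 hu_lim.
  (* Writing the vanishing terms as [0] times the limits of the brackets lets the limit be taken
     term by term. *)
  have -> : r = r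
    + 0 * (int_torus (fun x => m x * phi x) + int_torus (fun x => m x * L1 x))
    + 0 * (int_torus (fun x => m x * phi x) - int_torus (fun x => m x * L2 x)).
    by rewrite !mul0r !addr0.
  apply: cvgD; last by apply: cvgM => //; apply: cvgB; exact: mnc.
  apply: cvgD; last by apply: cvgM => //; apply: cvgD; exact: mnc.
  by apply: cvgB; exact: unc.
have H0_le : (eint_torus (fun x => (phi x * comp_H0 h H0 m u x)%:E) <= r%:E)%E.
  apply: le_trans (lsc mn un m u mnE hm hm_lim hu_lim) _.
  apply: limn_einf_le_cvg (_ : (rn n)%:E @[n --> \oo] --> r%:E)%E => [n|].
    apply: (regularized_solution_le Epos H_split a_smooth N0 _ (sol n)) => //.
    by have [_ _ b0 _ _] := hbeta (e1 n) (he1 n).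
  by apply: cvg_EFin; [exact: nearW|exact: rn_cvg].
move=> integrand.
(* For the limit pair only the existence of the integral of [phi * H0] is known, not its
   finiteness. *)
have [b [mb Hb] bpn] := semi_int m u hm hu.
have ic := ae_integrableB iup iuS.
have [] := semi_integrableD_le mb Hb bpn ic H0_le.
have integrandE t : phi (vec_of_tuple t) * comp_H0 h H0 m u (vec_of_tuple t) +
    (u (vec_of_tuple t) * phi (vec_of_tuple t) -
     u (vec_of_tuple t) * S (vec_of_tuple t)) = integrand (vec_of_tuple t).
  by rewrite /integrand /S /adjoint_diffusion; ring.
move=> [b' [mb' Hb'] bpn'] le0; split.
  exists b' => //; split => //; apply: filterS Hb' => t <-.
  by rewrite integrandE.
rewrite /eint_torus; under eq_integral do rewrite -integrandE.
apply: le_trans le0 _.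
(* The added term [u * phi - u * S] integrates to [- r], which cancels the bound [r]. *)
rewrite (RintegralB_ae iup iuS) lee_fin /r.
by rewrite subrKA subrr.
Qed.
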